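(* Let $m\geq1$ be an integer and $p\in[0,1)$. Then $$\mathbb{E}\,T_{m,p}=m\sum_{\ell=1}^m\frac1{\ell\,(1-p)^\ell}.$$ This quantity increases in both $m$ and $p$. Moreover, for each fixed $m$, the function $p\mapsto\mathbb{E}\,T_{m,p}$ is convex on $[0,1)$.
   Context: For an integer $m\geq 1$, let $\{C_n\}_{n\geq 1}$ be uniformly distributed on $[m]=\{1,\dots,m\}$ and $\{U_n\}_{n\geq1}$ be uniformly distributed on $(0,1)$, with the whole family $\{U_n,C_n\}_{n\geq1}$ independent. For $i\in[m]$ and $n>0$ let $L(i,n)=\sup\{1\leq k\leq n : C_k=i\}$ (with $\sup\emptyset=-\infty$). For $p\in[0,1)$ the clumsy coupon collection time is $$T_{m,p}=\inf\{n>0 : L(i,n)>0 \text{ and } U_{L(i,n)}\leq 1-p \text{ for all } i\in[m]\}.$$ *)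

(* Defs.v *)
From HB Require Import structures.
From mathcomp Require Import all_boot all_order all_algebra finmap.
From mathcomp Require Import all_classical all_reals all_analysis.

Set Implicit Arguments.
Unset Strict Implicit.
Unset Printing Implicit Defensive.

Import Order.TTheory GRing.Theory Num.Theory.
Import numFieldNormedType.Exports.

Local Open Scope classical_set_scope.
Local Open Scope ring_scope.

(* Mutual independence of a family of systems of events, possibly infinite:
   the product rule over every finite subfamily. *)
Definition mutually_independent (R : realType) d (Omega : measurableType d)
    (P : probability Omega R) (I : choiceType) (F : I -> set (set Omega)) :=
  forall (J : {fset I}) (A : I -> set Omega),
    (forall i, i \in J -> F i (A i)) ->
    P (\bigcap_(i in [set` J]) A i) = (\prod_(i <- J) P (A i))%E.

(* The random variables of index n = 0 are ignored throughout: the sequences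
   of the model are (C n) and (U n) for n >= 1. *)
Definition events_of_draws (R : realType) d (Omega : measurableType d)
    (C : nat -> Omega -> nat) (U : nat -> Omega -> R) (s : nat + nat) :
    set (set Omega) :=
  match s with
  | inl n => g_sigma_algebra_preimage (U n.+1)
  | inr n => g_sigma_algebra_preimage (C n.+1)
  end.

Record coupon_draws (R : realType) (m : nat) d (Omega : measurableType d)
    (P : probability Omega R)
    (C : nat -> {RV P >-> nat}) (U : nat -> {RV P >-> R}) : Prop := {
  uniform_coupon : forall n, (1 <= n)%N -> forall i, (1 <= i <= m)%N ->
    distribution P (C n) [set i] = (m%:R^-1)%:E ;
  uniform_mark : forall n, (1 <= n)%N -> forall A : set R, measurable A ->
    distribution P (U n) A = uniform_prob (@ltr01 R) A ;
  independent_draws :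
    mutually_independent P (events_of_draws (fun n => C n) (fun n => U n))
}.

(* L(i, n), with value -oo when i has not been drawn (ereal_sup set0 = -oo). *)
Definition last_draw (R : realType) (Omega : Type) (C : nat -> Omega -> nat)
    (i n : nat) (w : Omega) : \bar R :=
  ereal_sup [set (k%:R)%:E | k in [set k | (1 <= k <= n)%N /\ C k w = i]].

(* The existential only reads the extended real L(i, n) > 0 as an index.
   The time is +oo when the collection is never completed. *)
Definition clumsy_time (R : realType) (Omega : Type) (C : nat -> Omega -> nat)
    (U : nat -> Omega -> R) (m : nat) (p : R) (w : Omega) : \bar R :=
  ereal_inf [set (n%:R)%:E | n in [set n | (0 < n)%N /\
    forall i, (1 <= i <= m)%N ->
      (0 < last_draw R C i n w)%E /\
      exists2 k : nat, last_draw R C i n w = (k%:R)%:E & U k w <= 1 - p]].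

(* The library's 'E_P[X] takes real-valued X only. *)
Definition expected_clumsy_time (R : realType) d (Omega : measurableType d)
    (P : probability Omega R) (C : nat -> {RV P >-> nat})
    (U : nat -> {RV P >-> R}) (m : nat) (p : R) : \bar R :=
  (\int[P]_w clumsy_time (fun n => C n) (fun n => U n) m p w)%E.

(* Main.v *)
(** The number of good coupons (those whose last draw was marked at most [1 - p])
    is a birth-death chain on [0..m], and the collection time is its hitting
    time of [m].  Decomposing over all finite words of draws identifies
    [P (T > n)] with the probability that the chain started at [0] has not hit
    [m] by time [n]; since [T] is the sum of the indicators of [T > n], its mean
    is a series, which is summed by an explicit potential solving
    [f = 1 + (expected value of f after one step)].  With [q = 1 - p], the mean
    time to pass from [k] to [k+1] good coupons is
    [sum_(j < m) 'C(k, j) / 'C(m - 1, j) / q ^ (j + 1)], and summing over [k]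
    gives [m * sum_(l <= m) 1 / (l * q ^ l)].  Both monotonicities and convexity
    are read off this formula. *)
Require Import Defs.
From HB Require Import structures.
From mathcomp Require Import all_boot all_order all_algebra finmap.
From mathcomp Require Import all_classical all_reals all_analysis.
From mathcomp Require Import measurable_realfun ring lra zify.

Set Implicit Arguments.
Unset Strict Implicit.
Unset Printing Implicit Defensive.

Import Order.TTheory GRing.Theory Num.Theory.
Import numFieldNormedType.Exports.

Local Open Scope classical_set_scope.
Local Open Scope ring_scope.

(** * Killed birth-death chain and the sum of its survival probabilities *)

Section chain.
Variables (R : realType) (m : nat) (q : R).

(* One-step expectation operator of the chain killed on reaching [m]: a good
   coupon is drawn with probability [k / m], a draw is well marked with
   probability [q]. *)
Definition chain_step (f : nat -> R) (k : nat) : R :=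
  if (k < m)%N then
    ((m - k)%:R * (q * f k.+1 + (1 - q) * f k)
     + k%:R * (q * f k + (1 - q) * f k.-1)) / m%:R
  else 0.

(** Probability that the chain started at [k] stays below [m] at all times [0, ..., n]: the killed
    operator iterated on the indicator of the live states. *)
Definition survival (n k : nat) : R :=
  iter n chain_step (fun j => (j < m)%:R) k.

Lemma iter_chain_stepD n f g k :
  iter n chain_step (fun j => f j + g j) k =
  iter n chain_step f k + iter n chain_step g k.
Proof.
elim: n k => //= n IH k; rewrite /chain_step; case: ifP => _; last by rewrite addr0.
by rewrite !IH; ring.
Qed.

Lemma iter_chain_stepZ n (a : R) f k :
  iter n chain_step (fun j => a * f j) k = a * iter n chain_step f k.
Proof.
elim: n k => //= n IH k; rewrite /chain_step; case: ifP => _; last by rewrite mulr0.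
by rewrite !IH; ring.
Qed.

Hypothesis q01 : 0 <= q <= 1.

Lemma iter_chain_step_le n f g :
  (forall k, f k <= g k) ->
  forall k, iter n chain_step f k <= iter n chain_step g k.
Proof.
move=> fg; elim: n => //= n IH k; rewrite /chain_step; case: ifP => // _.
case/andP: q01 => q0 q1; have q1' : 0 <= 1 - q by rewrite subr_ge0.
by rewrite ler_wpM2r ?invr_ge0// lerD// ler_wpM2l// lerD// ler_wpM2l.
Qed.

Lemma survival_ge0 n k : 0 <= survival n k.
Proof.
have h : forall j, 0 * (j < m)%:R <= (j < m)%:R :> R by move=> j; rewrite mul0r.
by have := @iter_chain_step_le n _ _ h k; rewrite iter_chain_stepZ mul0r.
Qed.

(** Unfolding the fixed-point equation [N] times: each unfolding emits one survival term, and the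
    iterates of [f] telescope. *)
Lemma sum_survival f N k :
  (forall j, f j = (j < m)%:R + chain_step f j) ->
  \sum_(0 <= n < N) survival n k + iter N chain_step f k = f k.
Proof.
move=> fE; elim: N => [|N IH]; first by rewrite big_geq//= add0r.
rewrite big_nat_recr//= -addrA -[in RHS]IH; congr (_ + _).
have -> : iter N chain_step f k
  = iter N chain_step (fun j => (j < m)%:R + chain_step f j) k.
  by congr (iter _ _ _ _); apply/funext.
by rewrite iter_chain_stepD -iterSr.
Qed.

(** The partial sums are nondecreasing and bounded by [f k], so survival tends to 0. Since [f] is at
    most [F] times the indicator of the live states, the remainder in [sum_survival] is at most
    [F * survival n k] and vanishes too. *)
Lemma cvg_series_survival f F k :
  (forall j, f j = (j < m)%:R + chain_step f j) ->
  (forall j, 0 <= f j <= F * (j < m)%:R) ->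
  series (survival ^~ k) @ \oo --> f k.
Proof.
move=> fE fF.
have r0 n : 0 <= iter n chain_step f k.
  have h j : 0 * f j <= f j by rewrite mul0r; have /andP[] := fF j.
  by have := @iter_chain_step_le n _ _ h k; rewrite iter_chain_stepZ mul0r.
have rF n : iter n chain_step f k <= F * survival n k.
  by rewrite -iter_chain_stepZ; apply: iter_chain_step_le => j; have /andP[] := fF j.
have cs : cvgn (series (survival ^~ k)).
  apply: nondecreasing_is_cvgn.
    by apply/nondecreasing_seqP => n; rewrite seriesSr lerDl survival_ge0.
  exists (f k) => _ [n _ <-].
  by rewrite -(sum_survival n k fE) lerDl.
have s0 := cvg_series_cvg_0 cs.
have Fs0 : F * survival n k @[n --> \oo] --> 0.
  by rewrite -(mulr0 F); apply: cvgMr.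
have rr : iter n chain_step f k @[n --> \oo] --> 0.
  apply: (squeeze_cvgr _ (cvg_cst 0) Fs0).
  by apply: nearW => n; rewrite r0 rF.
have -> : series (survival ^~ k) = fun n => f k - iter n chain_step f k.
  by apply/funext => n; rewrite -[in RHS](sum_survival n k fE) addrK.
by rewrite -[X in _ --> X]subr0; apply: cvgB => //; exact: cvg_cst.
Qed.

End chain.

(** * Binomial identities and the explicit potential *)

Lemma natr_divE (R : realType) (a b c e : nat) :
  (a.+1 * b = c * e)%N -> b%:R = c%:R * e%:R / a.+1%:R :> R.
Proof.
move=> h; have a0 : a.+1%:R != 0 :> R by rewrite pnatr_eq0.
by apply: (mulfI a0); rewrite [RHS]mulrCA mulfV// mulr1 -!natrM h.
Qed.

Lemma sum_binl n j : (\sum_(0 <= i < n) 'C(i, j))%N = 'C(n, j.+1).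
Proof. by elim: n => [|n IH]; [rewrite big_geq | rewrite big_nat_recr//= IH binS]. Qed.

Section potential.
Variables (R : realType) (m : nat) (q : R).

Definition level_time (k : nat) : R :=
  \sum_(j < m) 'C(k, j)%:R / 'C(m.-1, j)%:R / q ^+ j.+1.

Definition remaining_time (k : nat) : R := \sum_(k <= i < m) level_time i.

Hypotheses (m0 : (0 < m)%N) (q0 : 0 < q).

Lemma bin_neq0 j : (j < m)%N -> 'C(m.-1, j)%:R != 0 :> R.
Proof. by move=> jm; rewrite pnatr_eq0 -lt0n bin_gt0; lia. Qed.

(** In state 0 no coupon is good, so the wait is geometric with success probability [q]; in the sum
    only [j = 0] survives. *)
Lemma level_time0 : q * level_time 0 = 1.
Proof.
rewrite /level_time -(prednK m0) big_ord_recl big1 => [|i _].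
  by rewrite !bin0 addr0 divr1 mul1r expr1 mulfV ?gt_eqF.
by rewrite bin_small ?mul0r.
Qed.

(** First-step equation, multiplied by [m]: a step down from [k.+1] costs an extra passage from [k]
    back to [k.+1]. The proof compares coefficients of the powers of [1 / q]. *)
Lemma level_timeS k : (k.+1 < m)%N ->
  (m - k.+1)%:R * q * level_time k.+1 = m%:R + k.+1%:R * (1 - q) * level_time k.
Proof.
move=> km; rewrite /level_time -(prednK m0) in km *.
move: km; set n := m.-1 => km; have {}km : (k < n)%N by lia.
pose c i j : R := 'C(i, j)%:R / 'C(n, j)%:R.
(* The identity between coefficients of [1 / q ^ j.+1]; all three binomials are reduced to
   ['C(n, j)] and ['C(k, j)]. *)
have cS j : (j < n)%N ->
    (n - k)%:R * c k.+1 j.+1 = k.+1%:R * (c k j - c k j.+1).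
  move=> jn; rewrite /c.
  have n0 : 'C(n, j)%:R != 0 :> R by rewrite pnatr_eq0 -lt0n bin_gt0 ltnW.
  have J0 : j.+1%:R != 0 :> R by rewrite pnatr_eq0.
  have nj0 : n%:R - j%:R != 0 :> R by rewrite subr_eq0 eqr_nat gtn_eqF.
  have hB : 'C(n, j.+1)%:R = (n%:R - j%:R) * 'C(n, j)%:R / j.+1%:R :> R.
    by rewrite -natrB ?(ltnW jn)//; exact: natr_divE (mul_bin_left n j).
  have hZ : 'C(k.+1, j.+1)%:R = k.+1%:R * 'C(k, j)%:R / j.+1%:R :> R.
    by apply: natr_divE; rewrite -mul_bin_diag.
  have hY : 'C(k, j.+1)%:R = (k%:R - j%:R) * 'C(k, j)%:R / j.+1%:R :> R.
    have [kj|jk] := ltnP k j; first by rewrite !bin_small ?mulr0 ?mul0r// ltnW.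
    by rewrite -natrB//; exact: natr_divE (mul_bin_left k j).
  rewrite hB hZ hY natrB ?(ltnW km)//; move: J0 nj0 n0.
  rewrite -!natr1 => J0 nj0 n0; field.
  by rewrite J0 nj0 n0.
have qE j : q * (c k.+1 j / q ^+ j.+1) = c k.+1 j / q ^+ j.
  by rewrite exprS; field; rewrite expf_neq0 ?gt_eqF.
rewrite -mulrA mulr_sumr (eq_bigr (fun j : 'I_n.+1 => c k.+1 j / q ^+ j));
  last by move=> j _; exact: qE.
have pE j : (1 - q) * (c k j / q ^+ j.+1) = c k j / q ^+ j.+1 - c k j / q ^+ j.
  by rewrite exprS; field; rewrite expf_neq0 ?gt_eqF.
rewrite -[X in _ = _ + X]mulrA [(1 - q) * _]mulr_sumr.
rewrite [X in _ = _ + _ * X](eq_bigr (fun j : 'I_n.+1 =>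
  c k j / q ^+ j.+1 - c k j / q ^+ j)); last by move=> j _; exact: pE.
(* Shifting indices aligns the powers of [q]. The last term has ['C(k, n) = 0] because [k < n], and
   the constant terms balance since [n - k = n.+1 - k.+1]. *)
rewrite sumrB big_ord_recl [in X in _ + _ * (X - _)]big_ord_recr.
rewrite [in X in _ + _ * (_ - X)]big_ord_recl /=.
rewrite {1 3 4}/c (bin_small km) !bin0 !mul0r addr0 expr0 !divr1 subSS.
set S1 := \sum_(i < n) _; set S2 := \sum_(i < n) _; set S3 := \sum_(i < n) _.
have h : (n - k)%:R * S1 = k.+1%:R * (S2 - S3).
  rewrite /S1 /S2 /S3 -sumrB !mulr_sumr; apply: eq_bigr => i _.
  by rewrite /bump/= !add1n mulrA cS// -mulrBl mulrA.
have -> : c k 0%N = 1 by rewrite /c !bin0 divr1.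
rewrite mulrDr h natrB ?(ltnW km)// -!natr1; ring.
Qed.

(** After exchanging the sums, the hockey-stick identity [sum_binl] gives ['C(m, j.+1)], whose
    quotient by ['C(m.-1, j)] is [m / j.+1]. *)
Lemma sum_level_time :
  remaining_time 0 = m%:R * \sum_(1 <= l < m.+1) (l%:R * q ^+ l)^-1.
Proof.
rewrite /remaining_time /level_time exchange_big/=.
rewrite big_add1/= big_mkord mulr_sumr; apply: eq_bigr => j _.
rewrite -!mulr_suml -natr_sum sum_binl.
have j0 : j.+1%:R != 0 :> R by rewrite pnatr_eq0.
have -> : 'C(m, j.+1)%:R = m%:R * 'C(m.-1, j)%:R / j.+1%:R :> R.
  by apply: natr_divE; rewrite -mul_bin_diag.
have := bin_neq0 (ltn_ord j); move: (_%:R) j0 => J J0 b0.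
by field; rewrite J0 b0 expf_neq0 ?gt_eqF.
Qed.

Lemma level_time_ge0 k : 0 <= level_time k.
Proof.
by apply: sumr_ge0 => j _; rewrite divr_ge0 ?divr_ge0// exprn_ge0// ltW.
Qed.

Lemma remaining_timeS k : (k < m)%N ->
  remaining_time k = level_time k + remaining_time k.+1.
Proof. by move=> km; rewrite /remaining_time big_ltn. Qed.

Lemma remaining_time_step k :
  remaining_time k = (k < m)%:R + chain_step m q remaining_time k.
Proof.
rewrite /chain_step; case: ifP => km; last first.
  by rewrite addr0 /remaining_time big_geq// leqNgt km.
have mn0 : m%:R != 0 :> R by rewrite pnatr_eq0 -lt0n.
(* State 0 is separate: there the truncated predecessor [0.-1 = 0] carries weight 0, and
   [level_time0] replaces [level_timeS]. *)
case: k km => [|k] km /=.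
  rewrite subn0 (remaining_timeS km); have := level_time0.
  move: (level_time 0) (remaining_time 1) => a b h.
  by rewrite mul0r addr0 mulrAC divff// mul1r; ring: h.
have km' : (k < m)%N by lia.
rewrite (remaining_timeS km) (remaining_timeS km') (remaining_timeS km).
have := level_timeS km; rewrite natrB ?(ltnW km)//.
move: (level_time k.+1) (level_time k) (remaining_time k.+2) => a b c.
move: (k.+1%:R : R) (m%:R : R) mn0 => K M M0 h.
apply: (mulfI M0); rewrite [RHS]mulrDr [X in _ = _ + X]mulrCA divff// !mulr1.
lra.
Qed.

End potential.


Lemma remaining_time_bound (R : realType) (m : nat) (q : R) (k : nat) :
  0 < q -> 0 <= remaining_time m q k <= remaining_time m q 0 * (k < m)%:R.
Proof.
move=> q0; rewrite /remaining_time sumr_ge0/= => [|i _]; last first.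
  exact: level_time_ge0.
have [km|mk] := ltnP k m; last by rewrite (@big_geq _ _ _ k)// mulr0.
rewrite mulr1 (@big_cat_nat _ _ _ k 0 m)//= ?(ltnW km)// lerDr sumr_ge0// => i _.
exact: level_time_ge0.
Qed.

(** * The closed form: limit of the series, monotonicity and convexity *)

Section collection_time.
Variable R : realType.

Definition collection_mean (m : nat) (p : R) : R :=
  m%:R * \sum_(1 <= l < m.+1) (l%:R * (1 - p) ^+ l)^-1.

Lemma cvg_series_survival0 (m : nat) (p : R) : (0 < m)%N -> 0 <= p < 1 ->
  series (fun n => survival m (1 - p) n 0) @ \oo --> collection_mean m p.
Proof.
move=> m0 /andP[p0 p1]; have q0 : 0 < 1 - p by rewrite subr_gt0.
rewrite /collection_mean -sum_level_time//.
apply: (@cvg_series_survival _ m (1 - p) _ _ (remaining_time m (1 - p) 0)).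
- by rewrite (ltW q0)/= lerBlDr lerDl.
- by move=> j; exact: remaining_time_step.
- by move=> j; exact: remaining_time_bound.
Qed.

Lemma collection_mean_lt_coupons (m m' : nat) (p : R) :
  (m < m')%N -> p < 1 -> collection_mean m p < collection_mean m' p.
Proof.
move=> mm' p1; have q0 : 0 < 1 - p by rewrite subr_gt0.
have t0 l : (0 < l)%N -> 0 < (l%:R * (1 - p) ^+ l)^-1.
  by move=> l0; rewrite invr_gt0 mulr_gt0 ?ltr0n ?exprn_gt0.
have s0 n : 0 <= \sum_(1 <= l < n.+1) (l%:R * (1 - p) ^+ l)^-1.
  by rewrite big_nat sumr_ge0// => l /andP[/t0/ltW].
apply: (@le_lt_trans _ _ (m'%:R * \sum_(1 <= l < m.+1) (l%:R * (1 - p) ^+ l)^-1)).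
  by rewrite ler_wpM2r ?ler_nat 1?ltnW.
rewrite ltr_pM2l ?ltr0n ?(leq_ltn_trans _ mm')//.
(* Strictness comes from the additional positive term [l = m.+1]. *)
rewrite [ltRHS](@big_cat_nat _ _ _ m.+1 1 m'.+1)//= 1?ltnW// ltrDl.
rewrite big_ltn// ltr_pwDl ?t0// big_nat sumr_ge0// => l /andP[ml _].
by rewrite ltW// t0// (leq_trans _ ml).
Qed.

Lemma collection_mean_lt_error (m : nat) (p p' : R) :
  (0 < m)%N -> p < p' -> p' < 1 -> collection_mean m p < collection_mean m p'.
Proof.
move=> m0 pp' p1; rewrite /collection_mean ltr_pM2l ?ltr0n//.
apply: ltr_sum_nat => // l /andP[l0 _].
have q0 : 0 < 1 - p' by rewrite subr_gt0.
have q0' : 0 < 1 - p by rewrite subr_gt0 (lt_trans pp').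
rewrite ltf_pV2 ?posrE ?mulr_gt0 ?ltr0n ?exprn_gt0// ltr_pM2l ?ltr0n//.
by rewrite ltrXn2r ?gtn_eqF// ?ltW//= ltrD2l ltrN2.
Qed.

Lemma conv_itv01 (t x y : R) : 0 <= t <= 1 -> 0 <= x < 1 -> 0 <= y < 1 ->
  0 <= t * x + (1 - t) * y < 1.
Proof.
move=> /andP[t0 t1] /andP[x0 x1] /andP[y0 y1].
rewrite addr_ge0 ?mulr_ge0 ?subr_ge0//=.
by have [xy|yx] := leP x y; nra.
Qed.

(** Induction on [l]; the gap created by one more factor is [t * (1 - t) * (u - v) * (u ^+ l - v ^+
    l)], whose last two factors have the same sign. *)
Lemma convex_exprn (t u v : R) l : 0 <= t <= 1 -> 0 <= u -> 0 <= v ->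
  (t * u + (1 - t) * v) ^+ l <= t * u ^+ l + (1 - t) * v ^+ l.
Proof.
move=> /andP[t0 t1] u0 v0; have t1' : 0 <= 1 - t by rewrite subr_ge0.
elim: l => [|l IH]; first by rewrite !expr0; lra.
rewrite exprS (le_trans (ler_wpM2l _ IH)) ?addr_ge0 ?mulr_ge0// -subr_ge0.
rewrite !exprS.
have -> : t * (u * u ^+ l) + (1 - t) * (v * v ^+ l) -
    (t * u + (1 - t) * v) * (t * u ^+ l + (1 - t) * v ^+ l) =
    (t * (1 - t)) * ((u - v) * (u ^+ l - v ^+ l)) by ring.
apply: mulr_ge0; first exact: mulr_ge0.
have [uv|/ltW vu] := leP u v.
  by rewrite mulr_le0 ?subr_le0// lerXn2r.
by rewrite mulr_ge0 ?subr_ge0// lerXn2r.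
Qed.

(** Multiplied by the convex combination of [x] and [y], the gap is
    [t * (1 - t) * (x - y) ^+ 2 / (x * y)]. *)
Lemma convex_inv (t x y : R) : 0 <= t <= 1 -> 0 < x -> 0 < y ->
  (t * x + (1 - t) * y)^-1 <= t * x^-1 + (1 - t) * y^-1.
Proof.
move=> /andP[t0 t1] x0 y0; have t1' : 0 <= 1 - t by rewrite subr_ge0.
have z0 : 0 < t * x + (1 - t) * y.
  have [->|tn0] := eqVneq t 0; first by rewrite mul0r subr0 mul1r add0r.
  by rewrite ltr_wpDr ?mulr_ge0 ?(ltW y0)// mulr_gt0// lt_def tn0.
rewrite -(ler_pM2l z0) mulfV ?gt_eqF// -subr_ge0.
have -> : (t * x + (1 - t) * y) * (t * x^-1 + (1 - t) * y^-1) - 1 =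
    t * (1 - t) * (x - y) ^+ 2 / (x * y).
  by field; rewrite !gt_eqF.
by apply: divr_ge0; apply: mulr_ge0; rewrite ?sqr_ge0 ?(ltW x0) ?(ltW y0)// mulr_ge0.
Qed.

(** Term by term: [(1 - p) ^- l] is the [l]-th power, convex and nondecreasing on nonnegative reals,
    of the convex function [(1 - p)^-1]. *)
Lemma convex_collection_mean (m : nat) (t p p' : R) :
  0 <= t <= 1 -> p < 1 -> p' < 1 ->
  collection_mean m (t * p + (1 - t) * p') <=
  t * collection_mean m p + (1 - t) * collection_mean m p'.
Proof.
move=> t01 p1 p1'; rewrite /collection_mean !(mulrCA _ m%:R) -mulrDr.
rewrite ler_wpM2l// !mulr_sumr -big_split/=.
apply: ler_sum_nat => l /andP[l0 _].
rewrite !invfM -!exprVn !(mulrCA _ l%:R^-1) -mulrDr ler_wpM2l ?invr_ge0//.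
have q0 : 0 < 1 - p by rewrite subr_gt0.
have q0' : 0 < 1 - p' by rewrite subr_gt0.
have {1}-> : 1 - (t * p + (1 - t) * p') = t * (1 - p) + (1 - t) * (1 - p').
  by ring.
apply: le_trans (convex_exprn l t01 _ _); rewrite ?invr_ge0 ?(ltW q0) ?(ltW q0')//.
have zi := convex_inv t01 q0 q0'.
have z0 : 0 <= (t * (1 - p) + (1 - t) * (1 - p'))^-1.
  case/andP: t01 => t0 t1; rewrite invr_ge0; apply: addr_ge0; apply: mulr_ge0.
  - exact: t0.
  - exact: ltW.
  - by rewrite subr_ge0.
  - exact: ltW.
by rewrite lerXn2r// nnegrE// (le_trans z0).
Qed.

End collection_time.

(** * Finite disjoint unions and the uniform law *)

Lemma measure_bigcup_fintype (R : realType) (d : measure_display)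
    (T : measurableType d) (mu : {measure set T -> \bar R})
    (I : finType) (F : I -> set T) :
  (forall i, measurable (F i)) -> trivIset setT F ->
  mu (\bigcup_i F i) = (\sum_(i : I) mu (F i))%E.
Proof.
move=> mF tF; rewrite measure_fin_bigcup//; last exact: finite_finset.
have -> : [set: I] = [set` enum I].
  by apply/seteqP; split => // x _ /=; rewrite mem_enum.
by rewrite -fsbig_seq ?enum_uniq// big_enum.
Qed.

Lemma uniform_prob_le (R : realType) (a : R) : 0 <= a <= 1 ->
  uniform_prob (@ltr01 R) [set x | x <= a] = a%:E.
Proof.
move=> /andP[a0 a1]; rewrite /uniform_prob integral_uniform_pdf.
have -> : [set x | x <= a] `&` `[0, 1] = `[0, a]%classic :> set R.
  apply/seteqP; split => x /=; rewrite !in_itv/=.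
    by move=> [-> /andP[->]].
  by move=> /andP[x0 xa]; rewrite x0 xa (le_trans xa).
rewrite (eq_integral (fun=> 1%E)) => [|x]; last first.
  rewrite inE/= in_itv/= /uniform_pdf => /andP[x0 xa].
  by rewrite x0 (le_trans xa)//= subr0 invr1.
rewrite integral_cst//= mul1e lebesgue_measure_itv/= lte_fin.
case: ltP => a0'; first by rewrite sube0.
by have -> : a = 0 by apply/eqP; rewrite eq_le a0 a0'.
Qed.

(** * Pathwise dynamics of the last draws and of the set of good coupons *)

Section last_draw.
Variables (R : realType) (Omega : Type) (C : nat -> Omega -> nat) (i : nat).
Variable w : Omega.

Lemma last_draw0 : last_draw R C i 0 w = -oo%E.
Proof.
rewrite /last_draw (_ : [set k | _ /\ _] = set0) ?image_set0 ?ereal_sup0//.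
by apply/seteqP; split => // k /= [/andP[]]; lia.
Qed.

Lemma last_drawS n :
  last_draw R C i n.+1 w =
  if C n.+1 w == i then (n.+1%:R)%:E else last_draw R C i n w.
Proof.
case: eqP => [Ci|Ci].
  apply/eqP; rewrite eq_le; apply/andP; split.
    apply: ge_ereal_sup => _ [k [/andP[_ kn] _] <-].
    by rewrite lee_fin ler_nat.
  by apply: ereal_sup_ubound; exists n.+1 => //=; rewrite leqnn.
rewrite /last_draw; congr (ereal_sup (image _ _)).
apply/seteqP; split => k /= [/andP[k1 kn] Ck]; split => //; last by rewrite k1 ltnW.
rewrite k1/= -ltnS ltn_neqAle kn andbT.
by apply/eqP => kE; apply: Ci; rewrite -kE.
Qed.

End last_draw.

Section good_set.
Variables (R : realType) (Omega : Type) (C : nat -> Omega -> nat).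
Variables (U : nat -> Omega -> R) (m : nat) (p : R).

Definition good (n : nat) (i : nat) (w : Omega) : Prop :=
  (0 < last_draw R C i n w)%E /\
  exists2 k : nat, last_draw R C i n w = (k%:R)%:E & U k w <= 1 - p.

(** Coupons are numbered from 1, so the ordinal [i] stands for the coupon [i.+1]. *)
Definition good_set (n : nat) (w : Omega) : {set 'I_m} :=
  [set i : 'I_m | `[< good n i.+1 w >]].

Lemma good_set0 w : good_set 0 w = finset.set0.
Proof.
by apply/setP => i; rewrite !inE; apply/asboolP => -[]; rewrite last_draw0.
Qed.

(** The new state depends only on the old state and on draw [n.+1]; this is what makes the process a
    chain. *)
Lemma in_good_setS n w i :
  (i \in good_set n.+1 w) =
  if C n.+1 w == i.+1 then U n.+1 w <= 1 - p else i \in good_set n w.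
Proof.
rewrite !inE /good last_drawS; case: eqP => // _.
apply/asboolP/idP => [[_ [k [/eqP]]]|Up].
  by rewrite eqr_nat => /eqP <-.
by split; [rewrite lte_fin ltr0n | exists n.+1].
Qed.

Lemma clumsy_timeE w :
  clumsy_time C U m p w =
  ereal_inf [set (n%:R)%:E | n in
    [set n | (0 < n)%N /\ good_set n w = finset.setT]].
Proof.
rewrite /clumsy_time; congr (ereal_inf (image _ _)).
apply/seteqP; split => n /= [n0 H]; split => //.
  by apply/setP => i; rewrite !inE; apply/asboolP; apply: H; rewrite ltn_ord.
case=> // i /andP[_ im].
by move/setP/(_ (Ordinal im)): H; rewrite !inE => /asboolP.
Qed.

(* The states at times [n, n + N] only: [running 0 n] is the event [T > n]. *)
Definition running (n N : nat) : set Omega :=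
  [set w | forall j, (n <= j <= n + N)%N -> good_set j w != finset.setT].

(** Layer-cake formula: [T] is the sum over [n] of the indicators of [T > n]. *)
Lemma clumsy_time_series w : (0 < m)%N ->
  clumsy_time C U m p w = (\sum_(n <oo) (\1_(running 0 n) w)%:E)%E.
Proof.
move=> m0; rewrite clumsy_timeE.
have T0 : good_set 0 w != finset.setT.
  rewrite good_set0; apply/eqP => /setP /(_ (Ordinal m0)).
  by rewrite !inE.
have [[n nT]|noT] := pselect (exists n, good_set n w == finset.setT); last first.
  have -> : [set n | (0 < n)%N /\ good_set n w = finset.setT] = set0.
    apply/seteqP; split => // n /= [_ /eqP nT]; apply: noT; by exists n.
  rewrite image_set0 ereal_inf0; apply/esym.
  have E n : (\1_(running 0 n) w)%:E = 1%E :> \bar R.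
    rewrite indicE mem_set// => j _; apply/negP => jT; apply: noT; by exists j.
  under eq_eseriesr do rewrite E.
  (* If the collection is never completed every indicator is 1, and [Num.bound A] of them already
     exceed [A]. *)
  apply/eqyP => A A0; apply: le_trans (nneseries_lim_ge (Num.bound A) _) => //.
  rewrite sumEFin lee_fin sumr_const_nat subn0.
  exact/ltW/archi_boundP/ltW.
have [N NT Nmin] :=
  ex_minnP (ex_intro (fun n => good_set n w == finset.setT) n nT).
(* The state at time 0 is empty, hence not full, so the constraint [0 < n] of the infimum does not
   exclude the first full time. *)
have N0 : (0 < N)%N by rewrite lt0n; apply/eqP => N0; rewrite N0 (negbTE T0) in NT.
have -> : ereal_inf [set (n%:R)%:E | n in
    [set n | (0 < n)%N /\ good_set n w = finset.setT]] = (N%:R)%:E :> \bar R.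
  apply/eqP; rewrite eq_le; apply/andP; split.
    by apply: ereal_inf_lbound; exists N => //; split => //; exact/eqP.
  by apply: le_ereal_inf_tmp => _ [k [_ /eqP/Nmin Nk] <-]; rewrite lee_fin ler_nat.
have E k : (\1_(running 0 k) w)%:E = ((k < N)%:R)%:E :> \bar R.
  rewrite indicE; congr (_%:R%:E); apply: congr1; apply/idP/idP.
    rewrite inE => /= rk; rewrite ltnNge; apply/negP => /rk.
    by rewrite NT.
  move=> kN; rewrite inE => j jk /=; apply/negP => /Nmin; lia.
under eq_eseriesr do rewrite E.
rewrite (nneseries_split 0 N)//.
rewrite eseries0 => [|k Nk _]; last by rewrite ltnNge Nk.
rewrite adde0 sumEFin; congr (_%:E).
rewrite big_nat (eq_bigr (fun=> 1)) => [|k /andP[_ ->]//].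
by rewrite -big_nat sumr_const_nat subn0.
Qed.

End good_set.

(** * Law of the draws, words of draws and the expectation *)

Section draws.
Variables (R : realType) (m : nat) (d : measure_display).
Variables (Omega : measurableType d) (P : probability Omega R).
Variables (C : nat -> {RV P >-> nat}) (U : nat -> {RV P >-> R}) (p : R).

Definition mark_set (b : bool) : set R := [set u | (u <= 1 - p) = b].

Definition mark_prob (b : bool) : R := if b then 1 - p else p.

(** A draw acts on the state only through its letter: a coupon and whether the mark is good. Letter
    [n] describes draw [n.+1], as draws start at 1. *)
Definition draw_event (n : nat) (y : 'I_m * bool) : set Omega :=
  [set w | C n.+1 w = y.1.+1 /\ mark_set y.2 (U n.+1 w)].

Lemma measurable_mark_set b : measurable (mark_set b).
Proof.
have E : mark_set true = `]-oo, (1 - p)]%classic.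
  by apply/seteqP; split => x; rewrite /mark_set/= in_itv.
case: b; first by rewrite E.
rewrite (_ : mark_set false = ~` mark_set true); last first.
  by apply/seteqP; split => x; rewrite /mark_set/=; case: (_ <= _).
by apply: measurableC; rewrite E.
Qed.

Lemma measurable_draw_event n y : measurable (draw_event n y).
Proof.
have -> : draw_event n y =
    (C n.+1 @^-1` [set y.1.+1 : nat]) `&` (U n.+1 @^-1` mark_set y.2) by [].
by apply: measurableI; rewrite -[X in measurable X]setTI;
  apply: measurable_funPT => //; exact: measurable_mark_set.
Qed.

Lemma trivIset_draw_event n : trivIset setT (draw_event n).
Proof.
move=> [c b] [c' b'] _ _ [w [/= [Cw Uw] [Cw' Uw']]].
congr (_, _); last exact: etrans (esym Uw) Uw'.
by apply/val_inj; have := etrans (esym Cw) Cw' => -[].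
Qed.

Lemma measurable_good_set n i :
  measurable [set w | i \in good_set (fun n => C n) (fun n => U n) m p n w].
Proof.
elim: n => [|n IH].
  rewrite (_ : mkset _ = set0)//; apply/seteqP; split => // w /=.
  by rewrite good_set0 inE.
rewrite (_ : mkset _ = draw_event n (i, true) `|`
    (~` (C n.+1 @^-1` [set i.+1 : nat]) `&`
    [set w | i \in good_set (fun n => C n) (fun n => U n) m p n w])).
  apply: measurableU; first exact: measurable_draw_event.
  apply: measurableI => //; apply: measurableC; rewrite -[X in measurable X]setTI.
  exact: measurable_funPT.
apply/seteqP; split => w /=; rewrite in_good_setS; case: eqP => Ci.
- by left.
- by right.
- by case=> [[]|[]].
- by case=> [[]|[]].
Qed.

Lemma measurable_running n N :
  measurable (running (fun n => C n) (fun n => U n) m p n N).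
Proof.
rewrite (_ : running _ _ _ _ _ _ = \bigcap_(j in [set j | (n <= j <= n + N)%N])
    ~` \bigcap_(i in [set: 'I_m])
    [set w | i \in good_set (fun n => C n) (fun n => U n) m p j w]).
  apply: fin_bigcap_measurable => [|j _].
    by apply: (@sub_finite_set _ _ `I_(n + N).+1) => // j /= /andP[].
  apply: measurableC.
  apply: fin_bigcap_measurable => [|i _]; first exact: finite_finset.
  exact: measurable_good_set.
apply/seteqP; split => w /= h j /=.
  move=> /h /negP; apply: contra_not => gT.
  by apply/eqP/setP => i; rewrite [RHS]finset.inE; apply: gT.
move=> jn; apply/negP => /eqP gT; apply: (h j jn) => i _ /=.
by rewrite gT finset.inE.
Qed.

Hypotheses (m0 : (0 < m)%N) (p01 : 0 <= p < 1) (draws : coupon_draws m C U).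

Lemma uniform_prob_mark_set b :
  uniform_prob (@ltr01 R) (mark_set b) = (mark_prob b)%:E.
Proof.
case/andP: p01 => p0 p1.
have E : uniform_prob (@ltr01 R) (mark_set true) = (1 - p)%:E.
  rewrite -uniform_prob_le; last by rewrite subr_ge0 (ltW p1)/= lerBlDr lerDl.
  by congr uniform_prob; apply/seteqP; split.
case: b => //=.
rewrite (_ : mark_set false = ~` mark_set true); last first.
  by apply/seteqP; split => x; rewrite /mark_set/=; case: (_ <= _).
rewrite probability_setC; last exact: measurable_mark_set.
by rewrite [X in (_ - X)%E]E -EFinB opprB addrC subrK.
Qed.

Lemma prob_draw_events (x : nat -> 'I_m * bool) (s : seq nat) : uniq s ->
  P [set w | forall i, i \in s -> draw_event i (x i) w] =
  (\prod_(i <- s) (m%:R^-1 * mark_prob (x i).2))%:E.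
Proof.
move=> us.
(* Each letter involves two members of the independent family, its mark ([inl]) and its coupon
   ([inr]). *)
pose r : seq (nat + nat) := map inl s ++ map inr s.
pose A (j : nat + nat) : set Omega := match j with
  | inl n => U n.+1 @^-1` mark_set (x n).2
  | inr n => C n.+1 @^-1` [set (x n).1.+1 : nat]
  end.
have hA i : i \in [fset j in r]%fset ->
    events_of_draws (fun n => C n) (fun n => U n) i (A i).
  by move=> _; case: i => n; eexists; rewrite ?setTI//; exact: measurable_mark_set.
have -> : [set w | forall i, i \in s -> draw_event i (x i) w] =
    \bigcap_(j in [set` [fset j in r]%fset]) A j.
  apply/seteqP; split => w /= h.
    case=> n /=; rewrite !inE ?mem_cat => /orP[] /mapP[i si] // [->];
      by case: (h i si).
  move=> i si; split.
    by apply: (h (inr i)); rewrite /= !inE ?mem_cat map_f ?orbT.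
  by apply: (h (inl i)); rewrite /= !inE ?mem_cat map_f.
rewrite (independent_draws draws hA) (perm_big r)/=; last first.
  apply: uniq_perm; first exact: fset_uniq.
    rewrite cat_uniq !map_inj_uniq ?us ?andbT//=; try by move=> ? ? [].
    by apply/hasPn => _ /mapP[i _ ->]; apply/mapP => -[].
  by move=> j; rewrite in_fset.
rewrite big_cat !big_map/= -big_split/= -prodEFin; apply: eq_bigr => i _.
rewrite muleC EFinM; congr (_ * _)%E.
  have c_m : (1 <= (x i).1.+1 <= m)%N := ltn_ord (x i).1.
  exact: (uniform_coupon draws (ltn0Sn i) c_m).
rewrite -uniform_prob_mark_set.
exact: (uniform_mark draws (ltn0Sn i) (measurable_mark_set (x i).2)).
Qed.

Lemma prob_draw_event n y : P (draw_event n y) = (m%:R^-1 * mark_prob y.2)%:E.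
Proof.
have := @prob_draw_events (fun=> y) [:: n] erefl; rewrite big_seq1 => <-.
congr (P _); apply/seteqP; split => w /=; first by move=> h i; rewrite inE => /eqP ->.
by apply; rewrite inE.
Qed.

(** The letters are disjoint with probabilities summing to 1. They cover [Omega] only up to a null
    set, since [C n.+1] may leave [[1, m]] with probability 0. *)
Lemma prob_split_draw n A : measurable A ->
  P A = (\sum_y P (A `&` draw_event n y))%E.
Proof.
move=> mA.
have mB : measurable (\bigcup_y draw_event n y).
  apply: fin_bigcup_measurable; first exact: finite_finset.
  by move=> y _; exact: measurable_draw_event.
have PB : P (\bigcup_y draw_event n y) = 1%E.
  rewrite measure_bigcup_fintype; last exact: trivIset_draw_event.
    rewrite (eq_bigr _ (fun y _ => prob_draw_event n y)).
    rewrite sumEFin; congr (_%:E).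
    rewrite -(pair_bigA _ (fun (c : 'I_m) b => m%:R^-1 * mark_prob b))/=.
    under eq_bigr do rewrite big_bool/= -mulrDr subrK mulr1.
    by rewrite sumr_const card_ord -[LHS]mulr_natl mulfV// pnatr_eq0 -lt0n.
  by move=> y; exact: measurable_draw_event.
have PC : P (~` \bigcup_y draw_event n y) = 0%E.
  by rewrite probability_setC// PB subee.
rewrite -(@measure_bigcup_fintype _ _ _ P _ (fun y => A `&` draw_event n y));
  last first.
- by apply: trivIset_setIl; exact: trivIset_draw_event.
- by move=> y; apply: measurableI => //; exact: measurable_draw_event.
rewrite -setI_bigcupr [LHS](measureDI _ mA mB).
rewrite [X in (X + _)%E](_ : _ = 0%E) ?add0e//.
apply: subset_measure0 PC => //.
- exact: measurableD.
- exact: measurableC.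
Qed.

(** Lumping of the set-valued chain to its cardinality: the sum splits according to whether the
    drawn coupon lies in [S], and each class contributes equal terms. *)
Lemma mean_survival_draw n (S : {set 'I_m}) : (#|S| < m)%N ->
  \sum_(y : 'I_m * bool) m%:R^-1 * mark_prob y.2 *
    survival m (1 - p) n #|if y.2 then (y.1 |: S)%SET else (S :\ y.1)%SET| =
  chain_step m (1 - p) (survival m (1 - p) n) #|S|.
Proof.
move=> Sm; rewrite /chain_step Sm.
rewrite -(pair_bigA _ (fun c (b : bool) => m%:R^-1 * mark_prob b *
  survival m (1 - p) n #|if b then (c |: S)%SET else (S :\ c)%SET|))/=.
under eq_bigr do rewrite big_bool/= -!mulrA -mulrDr.
rewrite -mulr_sumr mulrC; congr (_ / _).
rewrite (bigID (mem S))/= addrC; congr (_ + _).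
  rewrite (eq_bigr (fun=> (1 - p) * survival m (1 - p) n #|S|.+1 +
      (1 - (1 - p)) * survival m (1 - p) n #|S|)).
    rewrite sumr_const -[LHS]mulr_natl; congr (_%:R * _).
    apply: (@addnI #|S|); rewrite subnKC ?(ltnW Sm)//.
    exact: etrans (cardC (mem S)) (card_ord m).
  move=> c cS; rewrite cardsU1 cS add1n subKr; congr (_ + _ * survival _ _ _ _).
  by rewrite (cardsD1 c S) (negbTE cS).
rewrite (eq_bigr (fun=> (1 - p) * survival m (1 - p) n #|S| +
      (1 - (1 - p)) * survival m (1 - p) n #|S|.-1)).
  by rewrite sumr_const -[LHS]mulr_natl.
move=> c cS; rewrite cardsU1 cS add0n subKr; congr (_ + _ * survival _ _ _ _).
by rewrite (cardsD1 c S) cS.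
Qed.

Local Notation Good := (good_set (fun n => C n) (fun n => U n) m p).

Lemma good_setS_draw n y w : draw_event n y w ->
  Good n.+1 w = if y.2 then (y.1 |: Good n w)%SET else (Good n w :\ y.1)%SET.
Proof.
case: y => c b [/= Cw Uw]; apply/setP => i; rewrite in_good_setS Cw Uw eqSS.
rewrite eq_sym (inj_eq val_inj).
by case: b {Uw}; rewrite !finset.inE; case: (i == c).
Qed.

(* Induction on [N] backwards in time: conditioning on the draw [n.+1] extends
   the word [x 0, ..., x n.-1] of prescribed draws by one letter. *)
Lemma prob_running_from N n (x : nat -> 'I_m * bool) (S : {set 'I_m}) :
  (forall w, (forall i, i \in iota 0 n -> draw_event i (x i) w) ->
     Good n w = S) ->
  P ([set w | forall i, i \in iota 0 n -> draw_event i (x i) w] `&`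
     running (fun n => C n) (fun n => U n) m p n N) =
  ((\prod_(i <- iota 0 n) (m%:R^-1 * mark_prob (x i).2)) *
   survival m (1 - p) N #|S|)%:E.
Proof.
pose pre n (x : nat -> 'I_m * bool) : set Omega :=
  [set w | forall i, i \in iota 0 n -> draw_event i (x i) w].
pose run := running (fun n => C n) (fun n => U n) m p.
have mpre n' x' : measurable (pre n' x').
  rewrite (_ : pre _ _ = \bigcap_(i in [set` iota 0 n']) draw_event i (x' i)).
    by apply: fin_bigcap_measurable => // i _; exact: measurable_draw_event.
  by apply/seteqP; split.
rewrite -/(pre n x) -/(run n N).
elim: N n x S => [|N IH] n x S GS.
all: have [ST|ST] := eqVneq S finset.setT.
(* If [S] is full, the event is empty because [running] includes time [n], and survival from [m] is
   0. *)
- rewrite (_ : _ `&` _ = set0) ?measure0.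
    by rewrite ST cardsT card_ord /survival/= ltnn mulr0.
  apply/seteqP; split => // w [/GS Gn /(_ n)]; rewrite leqnn leq_addr Gn ST eqxx.
  by move=> /(_ isT).
- have Sm : (#|S| < m)%N.
    by rewrite -[ltnRHS](card_ord m) -cardsT proper_card// properT.
  rewrite /survival/= Sm mulr1 -prob_draw_events ?iota_uniq//.
  congr (P _); apply/seteqP; split => w /=; first by case.
  move=> xw; split => // j; rewrite addn0 => nj.
  by rewrite (_ : j = n) ?GS//; lia.
- rewrite (_ : _ `&` _ = set0) ?measure0.
    by rewrite ST cardsT card_ord /survival/= /chain_step ltnn mulr0.
  apply/seteqP; split => // w [/GS Gn /(_ n)]; rewrite leqnn leq_addr Gn ST eqxx.
  by move=> /(_ isT).
- have Sm : (#|S| < m)%N.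
    by rewrite -[ltnRHS](card_ord m) -cardsT proper_card// properT.
  rewrite (@prob_split_draw n); last first.
    by apply: measurableI => //; exact: measurable_running.
  rewrite [survival _ _ N.+1 _]/= -(mean_survival_draw N Sm) mulr_sumr -sumEFin.
  apply: eq_bigr => y _.
  pose x' i := if i == n then y else x i.
  have -> : pre n x `&` run n N.+1 `&` draw_event n y = pre n.+1 x' `&` run n.+1 N.
    apply/seteqP; split => w.
      move=> [[xw rw] yw]; split.
        move=> i; rewrite /x' mem_iota add0n ltnS /= leq_eqVlt.
        by case: eqVneq => [->|_ /= il]//; apply: xw; rewrite mem_iota.
      by move=> j nj; apply: rw; lia.
    move=> [xw rw].
    have xw' : pre n x w.
      move=> i; rewrite mem_iota => /= il.
      by have := xw i; rewrite /x' mem_iota ltn_eqF// /=; apply; lia.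
    split; last by have := xw n; rewrite /x' eqxx mem_iota; apply; lia.
    split=> // j nj; have [->|jn] := eqVneq j n; first by rewrite GS.
    by apply: rw; lia.
  rewrite (IH _ _ (if y.2 then (y.1 |: S)%SET else (S :\ y.1)%SET)).
    rewrite -[in iota _ _](addn1 n) iotaD big_cat big_seq1/= /x' eqxx.
    rewrite -[in LHS]mulrA; congr ((_ * _)%:E).
    rewrite !big_seq; apply: eq_bigr => i; rewrite mem_iota => /= il.
    by rewrite ltn_eqF.
  move=> w xw; rewrite (@good_setS_draw _ y); last first.
    by have := xw n; rewrite /x' eqxx mem_iota; apply; lia.
  rewrite GS// => i; rewrite mem_iota => /= il.
  by have := xw i; rewrite /x' mem_iota ltn_eqF// /=; apply; lia.
Qed.

Lemma prob_running n :
  P (running (fun n => C n) (fun n => U n) m p 0 n) = (survival m (1 - p) n 0)%:E.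
Proof.
(* The word is empty, so the letter supplied is arbitrary. *)
have := @prob_running_from n 0 (fun=> (Ordinal m0, true)) finset.set0.
rewrite big_nil mul1r cards0 => <- => [|w _]; last exact: good_set0.
by congr (P _); apply/seteqP; split => // w [].
Qed.

Lemma expected_clumsy_timeE :
  expected_clumsy_time C U m p = (collection_mean m p)%:E.
Proof.
rewrite /expected_clumsy_time.
under eq_integral do rewrite clumsy_time_series//.
(* Sum and integral are exchanged, the terms being nonnegative and measurable. *)
rewrite integral_nneseries//; last first.
  move=> n; apply/measurable_EFinP; apply: measurable_indic.
  exact: measurable_running.
have E n :
    (\int[P]_w (\1_(running (fun n => C n) (fun n => U n) m p 0 n) w)%:E)%E =
    (survival m (1 - p) n 0)%:E.
  rewrite integral_indic//; last exact: measurable_running.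
  by rewrite setIT; exact: prob_running.
under eq_eseriesr do rewrite E.
apply/cvg_lim => //.
rewrite (_ : (fun n => _) = EFin \o series (fun n => survival m (1 - p) n 0)).
  by apply: cvg_EFin; [exact: nearW | exact: cvg_series_survival0].
by apply/funext => n /=; rewrite sumEFin.
Qed.

End draws.

Theorem theorem3p11 (R : realType) (m : nat) (m_ge1 : (1 <= m)%N)
    (d : measure_display) (Omega : measurableType d) (P : probability Omega R)
    (C : nat -> {RV P >-> nat}) (U : nat -> {RV P >-> R})
    (draws : coupon_draws m C U) :
  [/\ forall p : R, 0 <= p < 1 ->
        expected_clumsy_time C U m p =
        (m%:R * \sum_(1 <= l < m.+1) (l%:R * (1 - p) ^+ l)^-1)%:E,
      forall (m' : nat) (d' : measure_display) (Omega' : measurableType d')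
          (P' : probability Omega' R)
          (C' : nat -> {RV P' >-> nat}) (U' : nat -> {RV P' >-> R}),
        (m < m')%N -> coupon_draws m' C' U' ->
        forall p : R, 0 <= p < 1 ->
          (expected_clumsy_time C U m p < expected_clumsy_time C' U' m' p)%E,
      forall p q : R, 0 <= p -> p < q -> q < 1 ->
        (expected_clumsy_time C U m p < expected_clumsy_time C U m q)%E
    & convex_function (`[0, 1[%classic : set R)
        (fun p : R => fine (expected_clumsy_time C U m p))].
Proof.
have mean := fun p => @expected_clumsy_timeE _ _ _ _ P C U p m_ge1 ^~ draws.
split.
- by move=> p /mean ->.
(* The two models may live on unrelated probability spaces; only their closed forms are compared. *)
- move=> m' d' Omega' P' C' U' mm' draws' p p01.
  rewrite mean// (expected_clumsy_timeE (leq_trans m_ge1 (ltnW mm')) p01 draws').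
  by rewrite lte_fin collection_mean_lt_coupons//; case/andP: p01.
- move=> p q p0 pq q1; rewrite !mean ?p0 ?(lt_trans pq)//.
    by rewrite lte_fin collection_mean_lt_error.
  by rewrite q1 (le_trans p0 (ltW pq)).
- move=> t x y; rewrite !inE/= !in_itv/= => x01 y01.
  have t01 : 0 <= t%:num <= 1 by rewrite ge0 le1.
  have cE : conv t x y = t%:num * (x : R) + (1 - t%:num) * (y : R).
    exact: convRE.
  (* The combination stays in [[0, 1[], so the closed form holds at all three points and [fine] acts
     on finite values. *)
  have z01 : 0 <= t%:num * (x : R) + (1 - t%:num) * (y : R) < 1.
    exact: conv_itv01.
  rewrite [leRHS]convRE cE /unstable.onem !mean//=.
  case/andP: x01 y01 => _ x1 /andP[_ y1].
  exact: convex_collection_mean.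
Qed.
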